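(* For every positive integer $n$, the class $\mathbf{SUB}_n$ is a finitely based variety of lattices (that is, $\mathbf{SUB}_n$ is exactly the class of all lattices satisfying some finite set of lattice identities).
   Context: For a poset $(P,\trianglelefteq)$, a subset $X\subseteq P$ is order-convex if $x\trianglelefteq z\trianglelefteq y$ and $\{x,y\}\subseteq X$ imply $z\in X$, for all $x,y,z\in P$. $\mathbf{Co}(P)$ denotes the lattice of all order-convex subsets of $P$ under inclusion. The length of $P$ is the supremum of $|C|-1$ where $C$ ranges over the finite subchains of $P$. For a positive integer $n$, $\mathbf{SUB}_n$ denotes the class of all lattices that admit a lattice embedding into $\mathbf{Co}(P)$ for some poset $P$ of length at most $n$. *)

(* Defs.v *)
From Stdlib Require List.
From HB Require Import structures.
From mathcomp Require Import all_boot all_order finmap.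
From mathcomp Require Import boolp classical_sets.
Set Implicit Arguments.
Unset Strict Implicit.
Unset Printing Implicit Defensive.
Import Order.TTheory.
Local Open Scope classical_set_scope.
Local Open Scope order_scope.

Definition order_convex (d : Order.disp_t) (P : porderType d) (X : set P) : Prop :=
  forall x y z : P, x <= z -> z <= y -> X x -> X y -> X z.

Record Co (d : Order.disp_t) (P : porderType d) : Type :=
  MkCo { Co_val :> set P ; _ : `[< order_convex Co_val >] }.

Section CoLattice.
Variables (d : Order.disp_t) (P : porderType d).

HB.instance Definition _ := [isSub for @Co_val d P].
HB.instance Definition _ := [Choice of Co P by <:].
HB.instance Definition _ :=
  [SubChoice_isSubPOrder of Co P by <: with set_display].

Lemma Co_convex (X : Co P) : order_convex X.
Proof. by case: X => X /= /asboolP. Qed.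

Lemma Co_leE (X Y : Co P) : (X <= Y) = `[< (X : set P) `<=` Y >].
Proof. by rewrite -Order.le_val. Qed.

Lemma order_convexI (X Y : set P) :
  order_convex X -> order_convex Y -> order_convex (X `&` Y).
Proof.
move=> cX cY x y z xz zy [Xx Yx] [Xy Yy].
by split; [apply: cX Xx Xy | apply: cY Yx Yy].
Qed.

Lemma order_convex_smallest (A : set P) :
  order_convex (smallest (@order_convex d P) A).
Proof.
move=> x y z xz zy Hx Hy B BA; have [cB _] := BA.
exact: cB xz zy (Hx B BA) (Hy B BA).
Qed.

Definition Co_meet (X Y : Co P) : Co P :=
  MkCo (asboolT (order_convexI (@Co_convex X) (@Co_convex Y))).

Definition Co_join (X Y : Co P) : Co P :=
  MkCo (asboolT (@order_convex_smallest (X `|` Y))).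

Lemma Co_meetP (X Y Z : Co P) : (X <= Co_meet Y Z) = (X <= Y) && (X <= Z).
Proof.
rewrite !Co_leE; apply/asboolP/andP => [/= H|[/asboolP XY /asboolP XZ] x Xx].
  by split; apply/asboolP => x /H [].
by split; [apply: XY | apply: XZ].
Qed.

Lemma Co_joinP (X Y Z : Co P) : (Co_join X Y <= Z) = (X <= Z) && (Y <= Z).
Proof.
rewrite !Co_leE; apply/asboolP/andP => [/= H|[/asboolP XZ /asboolP YZ] x /=].
  by split; apply/asboolP => x Hx; apply: H => B [_]; apply; [left | right].
apply; split; first exact: Co_convex.
by move=> y [/XZ|/YZ].
Qed.

HB.instance Definition _ :=
  Order.POrder_MeetJoin_isLattice.Build set_display (Co P) Co_meetP Co_joinP.

End CoLattice.

(* The length is the supremum of [#|C| - 1] over the finite chains [C], so it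
   is at most [n] when each of these numbers is.  Truncated subtraction only
   affects the empty chain. *)
Definition length_at_most (d : Order.disp_t) (P : porderType d) (n : nat) : Prop :=
  forall C : {fset P}, {in C &, forall x y, x >=< y} -> (#|` C| - 1 <= n)%N.

Definition lattice_embeds (d : Order.disp_t) (L : latticeType d)
    (d' : Order.disp_t) (L' : latticeType d') : Prop :=
  exists f : {lmorphism L -> L'}, injective f.

(* A class of lattices, over all carrier types and displays. *)
Definition lattice_class : Type := forall d : Order.disp_t, latticeType d -> Prop.

Definition SUB (n : nat) : lattice_class := fun d L =>
  exists (d' : Order.disp_t) (P : porderType d'),
    length_at_most P n /\ lattice_embeds L (Co P).

Inductive lattice_term : Type :=
| LVar of nat
| LMeet of lattice_term & lattice_term
| LJoin of lattice_term & lattice_term.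

Fixpoint leval (d : Order.disp_t) (L : latticeType d) (v : nat -> L)
    (t : lattice_term) : L :=
  match t with
  | LVar i => v i
  | LMeet s u => leval v s `&` leval v u
  | LJoin s u => leval v s `|` leval v u
  end.

(* The pair [(s, t)] stands for the identity s = t. *)
Definition lattice_identity : Type := (lattice_term * lattice_term)%type.

Definition satisfies (d : Order.disp_t) (L : latticeType d)
    (e : lattice_identity) : Prop :=
  forall v : nat -> L, leval v e.1 = leval v e.2.

Definition finitely_based_variety (K : lattice_class) : Prop :=
  exists E : seq lattice_identity, forall (d : Order.disp_t) (L : latticeType d),
    K d L <-> (forall e, List.In e E -> satisfies L e).

(* Main.v *)
Require Import Defs.
From Stdlib Require List.
From HB Require Import structures.
From mathcomp Require Import all_boot all_order finmap zify.
From mathcomp Require Import boolp classical_sets.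
Set Implicit Arguments.
Unset Strict Implicit.
Unset Printing Implicit Defensive.
Import Order.TTheory.
Local Open Scope classical_set_scope.
Local Open Scope order_scope.

(** The finite basis consists of inequalities of one shape, called rules here:
    pt /\ premise <= (pt /\ t_0) \/ ... \/ (pt /\ t_m). Such an inequality
    holds in Co(P) as soon as every point of [pt] that lies in the premise lies
    in one of the t_i, and it holds at a join-irreducible value of [pt] in the
    form: if [pt] is below the premise, then it is below one of the t_i. So one
    family of rules can be checked on points of a poset and exploited on
    join-irreducible elements of an abstract lattice, which play the role of
    points.

    Three rules describe betweenness. Udav: a point outside three convex sets
    cannot lie between each two of them. Bond: if a point lies between x and y
    and also between z and w, the four sets fall on two sides of it. Stirlitz:
    if p lies between x and c, and x lies between b0 and b1, then one of b0, b1
    prolongs the way from p to x. For each k < n a length rule forbids a chain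
    z_k' < ... < z_1 < p < y_1 < ... < y_l' with n + 2 points. All of them hold
    in Co(P) when P has length at most n, hence in its sublattices
    ([SUB_satisfies]).

    Conversely, let L satisfy these identities. So does its lattice K of
    filters ordered by reverse inclusion ([satisfies_filter]), which contains
    L, whose join-irreducible elements separate the elements of L, and in which
    an inequality p <= x \/ y can be shrunk to one with x minimal
    ([filter_minimal_covers]). By Udav and Bond, the relation of being the two
    terms x, y of a join above p, neither of which is itself above p, is, for
    join-irreducible p, a complete bipartite graph, so p has two sides
    ([well_sided_exists]). By Stirlitz and Udav, if x is a minimal element of
    one side of p, then exactly one of the two sides of x points away from p
    ([step_exists]); choosing this side to have the direction in which x lies
    from p orients x. Iterating, one obtains a tree of finite itineraries p, x,
    x', ..., in which each step goes up or down; the points of the required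
    poset are the itineraries, and s <= t when the tree path from s to t only
    goes up. Sending a to the set of the itineraries whose last element is
    below a gives convex sets, because the sides of the vertices along a
    monotone path are nested ([run_side], [bent_path_convex]), and preserves
    joins, because an itinerary whose last element lies nontrivially below x \/
    y has a neighbour below x on one side and one below y on the other
    ([nodes_belowU]). Finally, a chain of n + 2 itineraries spans a monotone
    tree path with at least n + 1 steps, and such a path violates a length rule
    at its turning point ([node_length]). *)

(** * Identities as disjunctive rules *)

(** The variable whose value plays the role of a point. *)
Notation pt := (LVar 0).

(** The alternatives are a nonempty list because a lattice may lack a least
    element to serve as an empty join. *)
Record rule := Rule {
  premise : lattice_term; alt0 : lattice_term; alts : seq lattice_term }.

Definition alternative (r : rule) (t : lattice_term) : Prop :=
  List.In t (alt0 r :: alts r).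

Definition rule_rhs (r : rule) : lattice_term :=
  foldr (fun t u => LJoin (LMeet pt t) u) (LMeet pt (alt0 r)) (alts r).

Definition rule_identity (r : rule) : lattice_identity :=
  (LMeet (LMeet pt (premise r)) (rule_rhs r), LMeet pt (premise r)).

Section Rules.
Context {d : Order.disp_t} {L : latticeType d}.
Implicit Types (v : nat -> L) (r : rule).

Lemma satisfies_ruleP r :
  satisfies L (rule_identity r) <->
  forall v, v 0%N `&` leval v (premise r) <= leval v (rule_rhs r).
Proof.
by split=> H v; [rewrite leEmeet; apply/eqP; apply: (H v)
                |move: (H v); rewrite leEmeet => /eqP].
Qed.

Lemma le_rule_rhs r v t :
  alternative r t -> v 0%N `&` leval v t <= leval v (rule_rhs r).
Proof.
case: r => lhs t0 ts; rewrite /alternative /rule_rhs /=.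
elim: ts => [|u ts IH] /=; first by case=> [->|[]].
case=> [t0t|[->|tts]]; [|exact: leUl|]; rewrite lexU2 // IH ?orbT //.
  by left.
by right.
Qed.

Definition irreducible (p : L) : Prop :=
  forall x y, p = x `|` y -> p = x \/ p = y.

Lemma irreducible_le p x y :
  irreducible p -> p <= x `|` y -> x <= p -> y <= p -> p <= x \/ p <= y.
Proof.
move=> irr lexy lexp leyp.
have /irr[->|->] : p = x `|` y by apply/le_anti; rewrite lexy leUx lexp.
- by left.
- by right.
Qed.

(** Below the join on the right-hand side, a join-irreducible element is below
    one of the joinands: this is what turns an identity into a disjunction. *)
Lemma irreducible_rule r v :
  satisfies L (rule_identity r) -> irreducible (v 0%N) ->
  v 0%N <= leval v (premise r) ->
  exists t, alternative r t /\ v 0%N <= leval v t.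
Proof.
move=> /satisfies_ruleP/(_ v) + irr lep; rewrite (meet_idPl lep).
case: r {lep} => lhs t0 ts; rewrite /alternative /rule_rhs /=.
elim: ts => [|u ts IH] /=.
  by rewrite lexI => /andP[_ le0]; exists t0; split=> //; left.
have rhs_le : leval v (foldr (fun t u => LJoin (LMeet pt t) u)
    (LMeet pt t0) ts) <= v 0%N.
  by elim: ts {IH} => [|u' ts IH] /=; rewrite ?leUx !leIl.
move=> /(irreducible_le irr)[]; rewrite ?leIl //.
  by rewrite lexI => /andP[_ leu]; exists u; split=> //; right; left.
by move=> /IH[t [[|] Ht let_]]; exists t; split=> //; [left | right; right].
Qed.

End Rules.

Lemma satisfies_embeds d (L : latticeType d) d' (M : latticeType d') e :
  lattice_embeds L M -> satisfies M e -> satisfies L e.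
Proof.
case=> f finj sat v; apply: finj.
have fE t : f (leval v t) = leval (f \o v) t.
  by elim: t => //= t <- u <-; rewrite ?omorphI ?omorphU.
by rewrite !fE sat.
Qed.

(** * Lattices of order-convex sets, point by point *)

(** Kept apart from the coercion of convex sets to sets so that simplification
    does not unfold joins of convex sets into intersections of convex
    supersets. *)
Definition has_point (d : Order.disp_t) (P : porderType d) (X : Co P) (q : P) :
  Prop := Co_val X q.
Arguments has_point : simpl never.
Notation "X \has q" := (has_point X q) (at level 70, no associativity).

Section ConvexSets.
Context {d : Order.disp_t} {P : porderType d}.
Implicit Types (X Y : Co P) (q x y : P) (e : bool).

(** [e] is a direction, [true] for up; treating both at once halves the case
    analyses below. *)
Definition beyond e : rel P := fun q x => if e then q < x else x < q.

Definition reaches e q X : Prop := exists2 x, X \has x & beyond e q x.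

Lemma beyond_trans e : transitive (beyond e).
Proof. by case: e => y x z /= => [|/[swap]]; apply: lt_trans. Qed.

Lemma beyondN e x y : beyond (~~ e) x y = beyond e y x.
Proof. by case: e. Qed.

Lemma reaches_both e q X : reaches e q X -> reaches (~~ e) q X -> X \has q.
Proof.
move=> [x Xx qx] [y Xy qy].
by case: e qx qy => /= qx qy;
  [apply: (Co_convex (ltW qy) (ltW qx)) | apply: (Co_convex (ltW qx) (ltW qy))].
Qed.

Lemma Co_leP X Y : reflect (forall q, X \has q -> Y \has q) (X <= Y).
Proof. by rewrite Co_leE; apply: asboolP. Qed.

Lemma Co_meetE X Y q : (X `&` Y : Co P) \has q = (X \has q /\ Y \has q).
Proof. by []. Qed.

(** The right-hand side is convex, since a point between two points that are in
    X or Y, or between X and Y, has on either side a point of X or a point of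
    Y. *)
Lemma Co_joinE X Y q : (X `|` Y : Co P) \has q <->
  [\/ X \has q, Y \has q | exists e, reaches e q X /\ reaches (~~ e) q Y].
Proof.
split; last first.
  have /Co_leP lX := leUl X Y; have /Co_leP lY := leUr Y X.
  case=> [/lX|/lY|[e [[x /lX Xx qx] [y /lY Yy qy]]]] //.
  by apply: (@reaches_both e); [exists x | exists y].
pose hull : set P := fun q =>
  [\/ X \has q, Y \has q | exists e, reaches e q X /\ reaches (~~ e) q Y].
move=> /(_ hull); apply; split; last first.
  by move=> x [Xx|Yx]; [apply: Or31 | apply: Or32].
move=> x y z xz zy Hx Hy.
have [->//|nxz] := eqVneq z x; have [->//|nzy] := eqVneq z y.
have {nxz xz} xz : x < z by rewrite lt_neqAle eq_sym nxz.
have {nzy zy} zy : z < y by rewrite lt_neqAle nzy.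
(* Each endpoint contributes, on its own side of z, a point of X or of Y. *)
have lo : reaches false z X \/ reaches false z Y.
  case: Hx => [Xx|Yx|[[] [[a Xa ax] [b Yb bx]]]].
  - by left; exists x.
  - by right; exists x.
  - by right; exists b => //=; apply: lt_trans bx xz.
  - by left; exists a => //=; apply: lt_trans ax xz.
have hi : reaches true z X \/ reaches true z Y.
  case: Hy => [Xy|Yy|[[] [[a Xa ay] [b Yb yb]]]].
  - by left; exists y.
  - by right; exists y.
  - by left; exists a => //=; apply: lt_trans zy ay.
  - by right; exists b => //=; apply: lt_trans zy yb.
case: lo hi => [lX|lY] [hX|hY].
- by apply: Or31; apply: reaches_both lX hX.
- by apply: Or33; exists false.
- by apply: Or33; exists true.
- by apply: Or32; apply: reaches_both lY hY.
Qed.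

Lemma Co_rule r :
  (forall (v : nat -> Co P) q, v 0%N \has q -> leval v (premise r) \has q ->
     exists t, alternative r t /\ leval v t \has q) ->
  satisfies (Co P) (rule_identity r).
Proof.
move=> H; apply/satisfies_ruleP => v; apply/Co_leP => q.
rewrite Co_meetE => -[vq lq]; have [t [rt tq]] := H v q vq lq.
by have /Co_leP := le_rule_rhs v rt; apply; rewrite Co_meetE.
Qed.

End ConvexSets.

(** * The Stirlitz, Udav and Bond rules *)

(** With p, x, b0, b1, c for the five variables: if p lies between x and c, and
    x between b0 and b1, then b0 or b1 lies beyond x as seen from p. A rule has
    only one premise, so that the condition on x is expressed by replacing x
    with its meet b' with b0 \/ b1. *)
Definition stirlitz : rule :=
  let b' := LMeet (LVar 1) (LJoin (LVar 2) (LVar 3)) in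
  let alt bi :=
    LMeet (LJoin bi (LVar 4)) (LJoin (LMeet b' (LJoin pt bi)) (LVar 4)) in
  Rule (LJoin b' (LVar 4)) b' [:: alt (LVar 2); alt (LVar 3)].

Definition udav : rule :=
  Rule (LMeet (LJoin (LVar 1) (LVar 2))
         (LMeet (LJoin (LVar 2) (LVar 3)) (LJoin (LVar 1) (LVar 3))))
    (LVar 1) [:: LVar 2; LVar 3].

Definition bond : rule :=
  Rule (LMeet (LJoin (LVar 1) (LVar 2)) (LJoin (LVar 3) (LVar 4)))
    (LVar 1) [:: LVar 2; LVar 3; LVar 4;
      LMeet (LJoin (LVar 1) (LVar 3)) (LJoin (LVar 2) (LVar 4));
      LMeet (LJoin (LVar 1) (LVar 4)) (LJoin (LVar 2) (LVar 3))].

Lemma eq_or_neg (e f : bool) : e = f \/ e = ~~ f.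
Proof. by case: e f => [] []; [left | right | right | left]. Qed.

Section BasicRulesCo.
Context {d : Order.disp_t} {P : porderType d}.

Lemma Co_stirlitz : satisfies (Co P) (rule_identity stirlitz).
Proof.
apply: Co_rule => v q aq; rewrite /alternative /=.
set A := v 0%N; set B := v 1%N; set B0 := v 2; set B1 := v 3; set C := v 4.
set b' := LMeet _ _.
case/Co_joinE => [bq|cq|[e [[x + qx] [c Cc qc]]]].
- by exists b'; split=> //; left.
- eexists; split; first by right; left; reflexivity.
  by rewrite /= Co_meetE; split; apply/Co_joinE; apply: Or32.
rewrite Co_meetE => -[Bx B01x].
(* q lies between x and c; whichever of B0, B1 continues from x away from q,
   or contains x, is the alternative that holds. *)
have key i (Bi := v i) : Bi \has x \/ reaches e x Bi ->
    (Bi `|` C : Co P) \has q /\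
    (B `&` (B0 `|` B1) `&` (A `|` Bi) `|` C : Co P) \has q.
  move=> near; split; apply/Co_joinE; apply: Or33; exists e; split.
  - case: near => [Bix|[y Biy xy]]; first by exists x.
    by exists y => //; apply: beyond_trans xy.
  - by exists c.
  - exists x => //; rewrite Co_meetE; split=> //; apply/Co_joinE.
    case: near => [|near]; [exact: Or32 | apply: Or33].
    by exists (~~ e); rewrite negbK; split=> //; exists q; rewrite ?beyondN.
  - by exists c.
have [near|near] :
  (B0 \has x \/ reaches e x B0) \/ (B1 \has x \/ reaches e x B1).
- case/Co_joinE: B01x => [|| [f [r0 r1]]]; [by left; left | by right; left |].
  by case: (eq_or_neg e f) => ->; [left|right]; right.
- by eexists; split; [right; left; reflexivity | exact: key].
- by eexists; split; [right; right; left; reflexivity | exact: key].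
Qed.

Lemma Co_udav : satisfies (Co P) (rule_identity udav).
Proof.
apply: Co_rule => v q aq; rewrite /alternative /= !Co_meetE.
move=> -[/Co_joinE H12 [/Co_joinE H23 /Co_joinE H13]].
have [|[|]] : v 1%N \has q \/ v 2 \has q \/ v 3 \has q; last 3 first.
- by exists (LVar 1); split=> //; left.
- by exists (LVar 2); split=> //; right; left.
- by exists (LVar 3); split=> //; right; right; left.
have c i e := @reaches_both _ _ e q (v i).
case: H12 => [?|?|[e [r1 r2]]]; [tauto | tauto |].
case: H23 => [?|?|[f [r3 r4]]]; [tauto | tauto |].
case: H13 => [?|?|[g [r5 r6]]]; [tauto | tauto |].
case: (eq_or_neg f e) => ef; rewrite {f}ef ?negbK in r3 r4.
  by right; left; apply: c r3 r2.
case: (eq_or_neg g e) => eg; rewrite {g}eg ?negbK in r5 r6.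
  by right; right; apply: c r4 r6.
by left; apply: c r1 r5.
Qed.

Lemma Co_bond : satisfies (Co P) (rule_identity bond).
Proof.
apply: Co_rule => v q aq; rewrite /alternative /= !Co_meetE.
move=> -[/Co_joinE H12 /Co_joinE H34].
case: H12 => [||[e [r1 r2]]].
- by exists (LVar 1); split=> //; left.
- by exists (LVar 2); split=> //; right; left.
case: H34 => [||[f [r3 r4]]].
- by exists (LVar 3); split=> //; right; right; left.
- by exists (LVar 4); split=> //; do 3 right; left.
case: (eq_or_neg e f) => ef; rewrite {e}ef ?negbK in r1 r2.
- eexists; split; first by do 5 right; left; reflexivity.
  rewrite /= Co_meetE; split; apply/Co_joinE; apply: Or33; first by exists f.
  by exists (~~ f); rewrite negbK.
- eexists; split; first by do 4 right; left; reflexivity.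
  rewrite /= Co_meetE; split; apply/Co_joinE; apply: Or33; last by exists f.
  by exists (~~ f); rewrite negbK.
Qed.

End BasicRulesCo.

(** * The length rules *)

(** The interpretation to keep in mind: apart from degenerate cases, a point of
    [arm z [:: (z2, w2); ...]] is in z and lies between a point of z2 and a
    point of w2, that point of z2 lies between a point of z3 and a point of w3,
    and so on. If each z_(i+1) is on the far side of z_i, this produces a
    chain. *)
Fixpoint arm (z : lattice_term) (l : seq (lattice_term * lattice_term)) :
    lattice_term :=
  if l is (z', w') :: l' then LMeet z (LJoin (arm z' l') w') else z.

(** The ways in which a point of [a], lying between the arm and [c], can fail
    to start such a chain. The next point is already in the rest of the arm or
    already in w' (the first two terms); or z' and w' have exchanged their
    sides, so that the point of z lies between [a] and w', and the point of [a]
    between w' and [c] (the third); or the failure occurs further along the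
    arm. *)
Fixpoint deviations (a c z : lattice_term)
    (l : seq (lattice_term * lattice_term)) : seq lattice_term :=
  if l is (z', w') :: l' then
    [:: LMeet a (LJoin (LMeet z (arm z' l')) c);
        LMeet a (LJoin (LMeet z w') c);
        LMeet a (LMeet (LJoin (LMeet z (LJoin a w')) c) (LJoin w' c))] ++
    [seq LMeet a (LJoin t c) | t <- deviations z w' z' l']
  else [::].

(** The successor keeps these variables distinct from [pt]. *)
Definition zvar (e : bool) (i : nat) := LVar (choice.pickle (e, false, i)).+1.
Definition wvar (e : bool) (i : nat) := LVar (choice.pickle (e, true, i)).+1.
Definition arm_vars (e : bool) (k : nat) :=
  [seq (zvar e i.+1, wvar e i.+1) | i <- iota 0 k].

(** With k and l further steps on the two arms, a point of [pt] between them
    and free of deviations yields a chain of k + l + 3 points. *)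
Definition length_rule (k l : nat) : rule :=
  let Z := arm (zvar false 0) (arm_vars false k) in
  let Y := arm (zvar true 0) (arm_vars true l) in
  Rule (LJoin Z Y) Z
    (Y :: deviations pt Y (zvar false 0) (arm_vars false k)
       ++ deviations pt Z (zvar true 0) (arm_vars true l)).

Lemma sorted_rev_cat (T : Type) (r : rel T) x s t :
  path (fun a b => r b a) x s -> path r x t -> sorted r (rev s ++ x :: t).
Proof.
elim: s x t => [|y s IH] x t //= /andP[yx ys] xt.
by rewrite rev_cons cat_rcons; apply: IH => //=; rewrite yx.
Qed.

Section LengthCo.
Context {d : Order.disp_t} {P : porderType d}.

(** Induction along the arm: the point q of z becomes the origin from which the
    rest of the arm is seen, with w' as the opposite set. *)
Lemma Co_arm (v : nat -> Co P) e l a c z q0 q r :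
  leval v a \has q0 -> leval v (arm z l) \has q -> leval v c \has r ->
  beyond e q0 q -> beyond (~~ e) q0 r ->
  (exists s, size s = size l /\ path (beyond e) q s) \/
  (exists t, List.In t (deviations a c z l) /\ leval v t \has q0).
Proof.
elim: l a c z q0 q r => [|[z' w'] l IH] a c z q0 q r aq0 /= zq cr q0q q0r.
  by left; exists [::].
have join_c t : leval v t \has q -> (leval v t `|` leval v c : Co P) \has q0.
  move=> tq; apply/Co_joinE; apply: Or33; exists e.
  by split; [exists q | exists r].
move: zq; rewrite Co_meetE => -[zq].
case/Co_joinE => [Zq|wq|[f [[q' Zq' qq'] [r' wr' qr']]]].
- right; eexists; split; first by left; reflexivity.
  by rewrite /= Co_meetE; split=> //; apply: (join_c (LMeet z (arm z' l))).
- right; eexists; split; first by right; left; reflexivity.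
  by rewrite /= Co_meetE; split=> //; apply: (join_c (LMeet z w')).
have [ef|ef] := eq_or_neg f e; rewrite {f}ef ?negbK in qq' qr'.
- have [[s [<- qs]]|[t [Ht tq]]] := IH _ _ _ _ _ _ zq Zq' wr' qq' qr'.
    by left; exists (q' :: s); rewrite /= qq'.
  right; exists (LMeet a (LJoin t c)); split; last first.
    by rewrite /= Co_meetE; split=> //; apply: join_c.
  by do 3 right; apply/List.in_map_iff; exists t.
- right; eexists; split; first by do 2 right; left; reflexivity.
  rewrite /= !Co_meetE; split=> //; split.
    apply: (join_c (LMeet z (LJoin a w'))).
    rewrite /= Co_meetE; split=> //; apply/Co_joinE; apply: Or33.
    exists (~~ e); split; first by exists q0; rewrite ?beyondN.
    by exists r'; rewrite ?negbK.
  apply/Co_joinE; apply: Or33; exists e; split; last by exists r.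
  by exists r' => //; apply: beyond_trans qr'.
Qed.

Lemma sorted_size_le n e (s : seq P) :
  length_at_most P n -> sorted (beyond e) s -> (size s <= n.+1)%N.
Proof.
move=> len; rewrite sorted_pairwise; last exact: beyond_trans.
move=> ps; have cs x y : x \in s -> y \in s -> x >=< y.
  have cmp (a b : P) : beyond e a b -> a >=< b.
    rewrite /beyond; case: e {ps} => /ltW; first exact: le_comparable.
    exact: ge_comparable.
  elim: s ps => //= a s IH /andP[/allP ha ps].
  rewrite !inE => /predU1P[->|xs] /predU1P[->|ys] //.
  - exact: comparablexx.
  - exact/cmp/ha.
  - by rewrite comparable_sym; apply/cmp/ha.
  - exact: IH.
have us : uniq s.
  apply: sorted_uniq (pairwise_sorted ps); first exact: beyond_trans.
  by move=> x; case: (e) => /=; rewrite ltxx.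
have := len [fset x in s]%fset; rewrite card_fseq undup_id // => H.
rewrite -[n.+1]add1n -leq_subLR; apply: H => x y.
by rewrite !inE; apply: cs.
Qed.

Lemma Co_length_rule k l :
  length_at_most P (k + l).+1 ->
  satisfies (Co P) (rule_identity (length_rule k l)).
Proof.
move=> len; apply: Co_rule => v q0 aq0; rewrite /alternative /=.
set Z := arm _ _; set Y := arm (zvar true _) _.
case/Co_joinE => [Zq|Yq|[e [[q Zq q0q] [r Yr q0r]]]].
- by exists Z; split=> //; left.
- by exists Y; split=> //; right; left.
have pq0 : leval v pt \has q0 by [].
have [[s [sk qs]]|[t [Ht tq]]] := Co_arm pq0 Zq Yr q0q q0r; last first.
  by exists t; split=> //; do 2 right; apply/List.in_app_iff; left.
have q0q' : beyond (~~ ~~ e) q0 q by rewrite negbK.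
have [[s' [sk' rs]]|[t [Ht tq]]] := Co_arm pq0 Yr Zq q0r q0q'; last first.
  by exists t; split=> //; do 2 right; apply/List.in_app_iff; right.
suff /(sorted_size_le len) : sorted (beyond e) (rev (r :: s') ++ q0 :: q :: s).
  by rewrite size_cat size_rev /= sk sk' !size_map !size_iota; lia.
apply: sorted_rev_cat => /=; last by rewrite q0q.
rewrite -beyondN q0r -(@eq_path _ (beyond (~~ e))) // => x y.
exact: beyondN.
Qed.

End LengthCo.

(** * The lattice of filters *)

Definition is_filter (d : Order.disp_t) (L : latticeType d) (F : set L) :
    Prop :=
  [/\ exists x, F x, forall x y, F x -> x <= y -> F y &
      forall x y, F x -> F y -> F (x `&` y)].

(** Filters are nonempty, but the improper filter is allowed: L may lack
    bounds. *)
Record lfilter (d : Order.disp_t) (L : latticeType d) : Type :=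
  LFilter { filter_set : set L; _ : `[< is_filter filter_set >] }.

Section FilterLattice.
Context {d : Order.disp_t} {L : latticeType d}.
Implicit Types F G H : lfilter L.

HB.instance Definition _ := [isSub for @filter_set d L].
HB.instance Definition _ := [Choice of lfilter L by <:].

Lemma filterP F : is_filter (filter_set F).
Proof. by case: F => F /= /asboolP. Qed.

(** Reverse inclusion, so that L embeds in its lattice of filters by principal
    filters; the join of two filters is their intersection. *)
Definition filter_le F G : bool := `[< filter_set G `<=` filter_set F >].

Fact filter_le_refl : reflexive filter_le.
Proof. by move=> F; apply/asboolP. Qed.

Fact filter_le_anti : antisymmetric filter_le.
Proof.
move=> F G /andP[/asboolP GF /asboolP FG]; apply: val_inj.
exact/seteqP.
Qed.

Fact filter_le_trans : transitive filter_le.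
Proof.
move=> G F H /asboolP GF /asboolP HG; apply/asboolP.
exact: subset_trans HG GF.
Qed.

HB.instance Definition _ := Order.Le_isPOrder.Build set_display (lfilter L)
  filter_le_refl filter_le_anti filter_le_trans.

Lemma filter_leP F G :
  reflect (forall x, filter_set G x -> filter_set F x) (F <= G).
Proof. exact: asboolP. Qed.

Fact filter_meet_subproof F G : `[< is_filter
  [set z | exists x y, [/\ filter_set F x, filter_set G y & x `&` y <= z]] >].
Proof.
have [[x Fx] Fup Fmeet] := filterP F; have [[y Gy] Gup Gmeet] := filterP G.
apply/asboolP; split.
- by exists (x `&` y), x, y.
- move=> z t [a [b [Fa Gb az]]] zt; exists a, b; split=> //.
  exact: le_trans zt.
- move=> z t [a [b [Fa Gb az]]] [a' [b' [Fa' Gb' at']]].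
  exists (a `&` a'), (b `&` b'); split; [exact: Fmeet | exact: Gmeet |].
  by rewrite meetACA leI2.
Qed.

Definition filter_meet F G : lfilter L := LFilter (filter_meet_subproof F G).

Fact filter_join_subproof F G :
  `[< is_filter (filter_set F `&` filter_set G) >].
Proof.
have [[x Fx] Fup Fmeet] := filterP F; have [[y Gy] Gup Gmeet] := filterP G.
apply/asboolP; split.
- by exists (x `|` y); split; [apply: Fup Fx _ | apply: Gup Gy _];
    rewrite ?leUl ?leUr.
- by move=> z t [Fz Gz] zt; split; [apply: Fup zt | apply: Gup zt].
- by move=> z t [Fz Gz] [Ft Gt]; split; [apply: Fmeet | apply: Gmeet].
Qed.

Definition filter_join F G : lfilter L := LFilter (filter_join_subproof F G).

Fact filter_meetP H F G : (H <= filter_meet F G) = (H <= F) && (H <= G).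
Proof.
have [[x Fx] _ _] := filterP F; have [[y Gy] _ _] := filterP G.
have [_ Hup Hmeet] := filterP H.
apply/filter_leP/andP => [le|[/filter_leP FH /filter_leP GH] z [a [b []]]].
  split; apply/filter_leP => z Az; apply: le.
    by exists z, y; split=> //; exact: leIl.
  by exists x, z; split=> //; exact: leIr.
by move=> /FH Ha /GH Hb; apply: Hup; apply: Hmeet.
Qed.

Fact filter_joinP F G H : (filter_join F G <= H) = (F <= H) && (G <= H).
Proof.
apply/filter_leP/andP => [le|[/filter_leP FH /filter_leP GH] z Hz].
  by split; apply/filter_leP => z /le[].
by split; [apply: FH | apply: GH].
Qed.

HB.instance Definition _ := Order.POrder_MeetJoin_isLattice.Build set_display
  (lfilter L) filter_meetP filter_joinP.

Lemma filter_meetE F G z : filter_set (F `&` G) z =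
  (exists x y, [/\ filter_set F x, filter_set G y & x `&` y <= z]).
Proof. by []. Qed.

Lemma filter_joinE F G z :
  filter_set (F `|` G) z = (filter_set F z /\ filter_set G z).
Proof. by []. Qed.

Lemma leval_mono (u v : nat -> L) t :
  (forall i, u i <= v i) -> leval u t <= leval v t.
Proof.
by move=> uv; elim: t => //= s IHs t IHt; [apply: leI2 | apply: leU2].
Qed.

(** Two valuations in the given filters can be replaced by their pointwise
    meet, because terms are monotone. *)
Lemma leval_filter (V : nat -> lfilter L) t c :
  filter_set (leval V t) c <->
  exists2 u, forall i, filter_set (V i) (u i) & leval u t <= c.
Proof.
have meet_pt u u' : (forall i, filter_set (V i) (u i)) ->
    (forall i, filter_set (V i) (u' i)) ->
    forall i, filter_set (V i) (u i `&` u' i).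
  by move=> Vu Vu' i; have [_ _] := filterP (V i); apply.
elim: t c => [i|s IHs t IHt|s IHs t IHt] c /=.
- split=> [Vc|[u Vu uc]]; last by have [_ up _] := filterP (V i); apply: up uc.
  have /choice[w Vw] j : exists x, filter_set (V j) x.
    by have [] := filterP (V j).
  exists (fun j => if j == i then c else w j); last by rewrite eqxx.
  by move=> j; case: eqP => [->|].
- split=> [[x [y [/IHs[u Vu ux] /IHt[u' Vu' uy] xy]]]|].
    exists (fun i => u i `&` u' i); first exact: meet_pt.
    apply: le_trans xy; apply: leI2.
      by apply: le_trans ux; apply: leval_mono => i; apply: leIl.
    by apply: le_trans uy; apply: leval_mono => i; apply: leIr.
  case=> u Vu uc; exists (leval u s), (leval u t); split=> //.
    by apply/IHs; exists u.
  by apply/IHt; exists u.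
- split=> [[/IHs[u Vu ux] /IHt[u' Vu' uy]]|].
    exists (fun i => u i `&` u' i); first exact: meet_pt.
    rewrite leUx; apply/andP; split.
      by apply: le_trans ux; apply: leval_mono => i; apply: leIl.
    by apply: le_trans uy; apply: leval_mono => i; apply: leIr.
  case=> u Vu; rewrite leUx => /andP[us ut].
  by split; [apply/IHs | apply/IHt]; exists u.
Qed.

Lemma satisfies_filter e : satisfies L e -> satisfies (lfilter L) e.
Proof.
move=> sat V; apply: val_inj; apply/seteqP.
by split=> c /leval_filter[u Vu uc]; apply/leval_filter; exists u => //;
  rewrite ?sat // -sat.
Qed.

Fact principal_subproof a : `[< is_filter [set x : L | a <= x] >].
Proof.
apply/asboolP; split; [by exists a => /= | by move=> x y /= /le_trans; apply|].
by move=> x y /= ax ay; rewrite lexI ax.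
Qed.

Definition principal a : lfilter L := LFilter (principal_subproof a).

Lemma le_principal F a : F <= principal a <-> filter_set F a.
Proof.
split=> [/filter_leP|Fa]; first by apply; apply: lexx.
by apply/filter_leP => x ax; have [_ up _] := filterP F; apply: up ax.
Qed.

Lemma principalI a b : principal (a `&` b) = principal a `&` principal b.
Proof.
apply/le_anti/andP; split.
  rewrite lexI; apply/andP; split; apply/le_principal => /=;
  [exact: leIl | exact: leIr].
by apply/le_principal; rewrite filter_meetE; exists a, b; split=> //=.
Qed.

Lemma principalU a b : principal (a `|` b) = principal a `|` principal b.
Proof.
apply: val_inj; apply/seteqP; split=> x /=; first by rewrite leUx => /andP.
by case=> /= ax bx; rewrite leUx ax.
Qed.

(** Zorn: a union of a chain of filters avoiding N is again one. The empty set
    is added to the family to bound the empty chain. *)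
Lemma filter_maximal F (N : set L) : (forall x, filter_set F x -> ~ N x) ->
  exists G, [/\ G <= F, forall x, filter_set G x -> ~ N x &
    forall H, H <= G -> (forall x, filter_set H x -> ~ N x) -> G <= H].
Proof.
move=> FN.
pose good (A : set L) :=
  [/\ is_filter A, filter_set F `<=` A & forall x, A x -> ~ N x].
have [C CP Ctot|A [[A0|[filA FA AN]] Amax]] :=
    @Zorn_bigcup L [set A | A = set0 \/ good A].
- have [noF|[A0 [CA0 [x0 A0x0]]]] :
      (forall A, C A -> A = set0) \/ (exists A, C A /\ exists x, A x).
  + have [H|/existsNP[A /not_implyP[CA /eqP/set0P[x Ax]]]] :=
      pselect (forall A, C A -> A = set0); first by left.
    by right; exists A; split=> //; exists x.
  + by left; apply/seteqP; split=> // x [A CA]; rewrite (noF _ CA).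
  have goodC A x : C A -> A x -> good A.
    by move=> CA Ax; case: (CP _ CA) => // A0'; rewrite A0' in Ax.
  have [[_ _ _] FA0 _] := goodC _ _ CA0 A0x0.
  right; split; last first.
  + by move=> x [A CA Ax]; have [_ _] := goodC _ _ CA Ax; apply.
  + by move=> x /FA0 A0x; exists A0.
  + split; first by exists x0, A0.
    * move=> x y [A CA Ax] xy; exists A => //.
      by have [[_ up _] _ _] := goodC _ _ CA Ax; apply: up xy.
    * move=> x y [A CA Ax] [B CB By].
      have [AB|BA] := Ctot _ _ CA CB.
        exists B => //; have [[_ _ me] _ _] := goodC _ _ CB By.
        by apply: me => //; apply: AB.
      exists A => //; have [[_ _ me] _ _] := goodC _ _ CA Ax.
      by apply: me => //; apply: BA.
- exfalso; have [[x Fx] _ _] := filterP F.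
  apply: (Amax (filter_set F)); last by right; split=> //; exact: filterP.
  by rewrite A0; split=> // /(_ x Fx).
exists (LFilter (asboolT filA)); split=> //; first exact/filter_leP.
move=> H /filter_leP /= AH HN; apply/filter_leP => /= x Hx.
apply: contrapT => nAx; apply: (Amax (filter_set H)).
  by split=> // /(_ x Hx).
right; split=> //; first exact: filterP.
by move=> y /FA; apply: AH.
Qed.

End FilterLattice.

(** * The two sides of a join-irreducible element *)

Section Sides.
Context {d : Order.disp_t} {K : latticeType d}.
Implicit Types (p x y z w b c : K) (e f : bool).

Definition straddles p x y : Prop :=
  [/\ ~ p <= x, ~ p <= y & p <= x `|` y].

Lemma straddlesC p x y : straddles p x y -> straddles p y x.
Proof. by case=> px py pxy; split=> //; rewrite joinC. Qed.

Definition minimal_in (A : set K) x : Prop :=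
  A x /\ forall y, y <= x -> A y -> x <= y.

(** A weak form of lower continuity, which stands in for the finiteness of the
    lattice. *)
Definition minimal_covers : Prop := forall p x y, p <= x `|` y ->
  exists2 z, z <= x & minimal_in [set z | p <= z `|` y] z.

(** An element with an orientation: the set [s.2 e] collects the elements that
    lie from [s.1] in direction [e]. *)
Definition state : Type := (K * (bool -> set K))%type.
Implicit Types (s t : state).

(** The graph of the relation [straddles s.1] is complete bipartite with the
    two sides as its colour classes, both of which are empty if there is no
    edge. *)
Definition well_sided s : Prop :=
  [/\ irreducible s.1,
      forall e x y, s.2 e x -> s.2 (~~ e) y -> straddles s.1 x y,
      forall x y, straddles s.1 x y -> exists e, s.2 e x /\ s.2 (~~ e) y &
      forall e x, s.2 e x -> exists y, s.2 (~~ e) y].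

(** The move from [s] to a minimal element [t.1] of its side [e], oriented so
    that [t.2 e] points away from [s]: its elements prolong the way from [s.1]
    to [t.1], and they are still opposite to the other side of [s.1]. *)
Definition step e s t : Prop :=
  [/\ minimal_in (s.2 e) t.1, well_sided t &
      forall b, t.2 e b ->
        t.1 <= s.1 `|` b /\ forall w, s.2 (~~ e) w -> s.1 <= b `|` w].

Lemma side_excl s e x : well_sided s -> s.2 e x -> ~ s.2 (~~ e) x.
Proof.
by case=> _ opp _ _ ex /(opp _ _ _ ex)[nsx _]; rewrite joinxx.
Qed.

Lemma straddles_side s e x w :
  well_sided s -> straddles s.1 x w -> s.2 (~~ e) w -> s.2 e x.
Proof.
move=> ws xw; have [_ _ /(_ _ _ xw)[f [fx fw]] _] := ws.
have [->|fe] := eq_or_neg e f; first by [].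
by rewrite fe negbK => /(side_excl ws); case/(_ fw).
Qed.

(** If b points away from [t.1], then [s.1] is not below b, since otherwise t.1
    <= s.1 \/ b = b; so b straddles [s.1] together with every w on the other
    side. *)
Lemma step_side e s t b : well_sided s -> step e s t -> t.2 e b -> s.2 e b.
Proof.
move=> ws [[st _] wt away] tb; have [tsb sbw] := away b tb.
have [_ oppt _ net] := wt; have [_ opps _ nes] := ws.
have [w sw] := nes _ _ st; have [c tc] := net _ _ tb.
have [ntb _ _] := oppt _ _ _ tb tc; have [_ nsw _] := opps _ _ _ st sw.
apply: (straddles_side ws _ sw); split=> //; last exact: sbw.
by move=> /join_idPl sb; apply: ntb; move: tsb; rewrite joinC sb.
Qed.

Hypothesis Kstirlitz : satisfies K (rule_identity stirlitz).
Hypothesis Kudav : satisfies K (rule_identity udav).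
Hypothesis Kbond : satisfies K (rule_identity bond).

Lemma udav_irreducible p x y z : irreducible p ->
  p <= x `|` y -> p <= y `|` z -> p <= x `|` z -> [\/ p <= x, p <= y | p <= z].
Proof.
move=> irr xy yz xz.
have [|t [/= t_in]] :=
    @irreducible_rule _ _ _ (nth p [:: p; x; y; z]) Kudav irr.
  by rewrite /= !lexI xy yz xz.
by case: t_in => [|[|[]//]] <- /=; [apply: Or31 | apply: Or32 | apply: Or33].
Qed.

Lemma bond_irreducible p x y z w : irreducible p ->
  straddles p x y -> straddles p z w ->
  (p <= x `|` z /\ p <= y `|` w) \/ (p <= x `|` w /\ p <= y `|` z).
Proof.
move=> irr [px py xy] [pz pw zw].
have [|t [/= t_in]] :=
    @irreducible_rule _ _ _ (nth p [:: p; x; y; z; w]) Kbond irr.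
  by rewrite /= !lexI xy zw.
case: t_in => [|[|[|[|[|[|[]//]]]]]] <- //=; rewrite lexI => /andP[? ?];
  by [left | right].
Qed.

Lemma stirlitz_irreducible p x y b0 b1 : irreducible p ->
  p <= x `|` y -> x <= b0 `|` b1 -> ~ p <= x ->
  exists b, (b = b0 \/ b = b1) /\
    p <= b `|` y /\ p <= (x `&` (p `|` b)) `|` y.
Proof.
move=> irr xy xb px.
have [|t [/= t_in]] :=
    @irreducible_rule _ _ _ (nth p [:: p; x; b0; b1; y]) Kstirlitz irr.
  by rewrite /= (meet_idPl xb).
case: t_in => [|[|[|[]//]]] <- /=; rewrite !(meet_idPl xb) //;
  rewrite lexI => /andP[pb pxb]; [exists b0 | exists b1]; split=> //;
  by [left | right].
Qed.

(** If x is a join of u and v, Stirlitz puts p below u \/ y or v \/ y, so that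
    by minimality x is u or v. *)
Lemma minimal_cover_irreducible p x y : irreducible p -> ~ p <= x ->
  minimal_in [set z | p <= z `|` y] x -> irreducible x.
Proof.
move=> irr px [/= xy xmin] u v xuv.
have xle : x <= u `|` v by rewrite xuv.
have [b [b_in [pby _]]] := stirlitz_irreducible irr xy xle px.
have bx : b <= x by case: b_in => ->; rewrite xuv ?leUl ?leUr.
have /eqP : x == b by rewrite eq_le bx xmin.
by case: b_in => -> ->; [left | right].
Qed.

(** The sides are the neighbourhoods of the two ends of any edge of the graph
    of [straddles p]: by Bond any two edges are joined by two further edges,
    and by Udav there is no triangle. *)
Lemma well_sided_exists p : irreducible p -> exists sd, well_sided (p, sd).
Proof.
move=> irr.
have [[x0 [y0 xy0]]|no] := pselect (exists x y, straddles p x y); last first.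
  exists (fun=> set0); split=> //= x y xy.
  by case: no; exists x, y.
have [px0 py0 pxy0] := xy0.
exists (fun e => if e then [set x | straddles p x y0]
                 else [set y | straddles p x0 y]).
have opp x y : straddles p x y0 -> straddles p x0 y -> straddles p x y.
  move=> xy [_ py pxy]; have [px _ pxy0'] := xy.
  have [[xx0 yy0]|[]//] := bond_irreducible irr xy (And3 px0 py pxy).
  by case: (udav_irreducible irr xx0 pxy0 pxy0').
split=> //=.
- move=> [] x y /= h1 h2; first exact: opp.
  exact/straddlesC/opp.
- move=> x y xy; have [px py pxy] := xy.
  have [[? ?]|[? ?]] := bond_irreducible irr xy xy0.
    exists false; split=> //=; split=> //; rewrite joinC //.
  by exists true; split=> //=; split=> //; rewrite joinC.
- by move=> [] x /= _; [exists y0 | exists x0].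
Qed.

(** Only one of two straddling elements can point away from p. If both did,
    then first p, b0, b1 would form a forbidden triple for x, which forces x <=
    p, and then so would w, b0, b1, which forces x <= w. *)
Lemma away_unique p x w b0 b1 : irreducible x -> ~ p <= w -> p <= x `|` w ->
  straddles x b0 b1 -> x <= p `|` b0 -> p <= b0 `|` w ->
  x <= p `|` b1 -> ~ p <= b1 `|` w.
Proof.
move=> xirr pw pxw [nb0 nb1 xb] xb0 pb0 xb1 pb1.
have xp : x <= p.
  by rewrite joinC in xb0; have [] := udav_irreducible xirr xb0 xb1 xb.
have xb0w := le_trans xp pb0; have := le_trans xp pb1; rewrite joinC => xwb1.
have [//|xw|//] := udav_irreducible xirr xb0w xwb1 xb.
by apply: pw; rewrite -(join_idPl xw) joinC.
Qed.

(** For each pair that straddles x, Stirlitz makes one member point away from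
    [s.1], the minimality of x giving x <= s.1 \/ b, and [away_unique] excludes
    the other. By Bond these choices are consistent from one pair to another.
    *)
Lemma step_exists e s x : well_sided s -> minimal_in (s.2 e) x ->
  irreducible x -> exists sd, step e s (x, sd).
Proof.
move=> ws [sx xmin] xirr; have [irr opp cov ne] := ws.
have [w sw] := ne _ _ sx; have [px pw pxw] := opp _ _ _ sx sw.
pose away b := [/\ exists c, straddles x b c, x <= s.1 `|` b &
  forall w', s.2 (~~ e) w' -> s.1 <= b `|` w'].
have away_or b0 b1 : straddles x b0 b1 -> away b0 \/ away b1.
  move=> sb; have [nb0 nb1 xb] := sb.
  have [b [b_in [pb pxb]]] := stirlitz_irreducible irr pxw xb px.
  suff : away b by case: b_in => ->; [left | right].
  have xpb : x <= s.1 `|` b.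
    suff : x <= x `&` (s.1 `|` b) by rewrite lexI => /andP[].
    apply: xmin (leIl _ _) _; apply: straddles_side ws _ sw; split=> //.
    by move=> /le_trans/(_ (leIl _ _)).
  have [c xbc] : exists c, straddles x b c.
    by case: b_in => ->; [exists b1 | exists b0; apply: straddlesC].
  split=> //; first by exists c.
  have npb : ~ s.1 <= b.
    by case: xbc => nxb _ _ /join_idPl pb'; apply: nxb; rewrite -pb' joinC.
  have sb' : s.2 e b by apply: straddles_side ws _ sw.
  by move=> w' sw'; have [] := opp _ _ _ sb' sw'.
have away_excl b0 b1 : straddles x b0 b1 -> away b0 -> ~ away b1.
  move=> sb [_ xb0 pb0] [_ xb1 pb1].
  exact: away_unique xirr pw pxw sb xb0 (pb0 _ sw) xb1 (pb1 _ sw).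
have neqF : (~~ e == e) = false by case: (e).
exists (fun f => if f == e then away
                 else [set c | exists2 b, away b & straddles x b c]).
have opp' b c : away b -> (exists2 b', away b' & straddles x b' c) ->
    straddles x b c.
  move=> ab [b' ab' bc']; have [[c' bc] _ _] := ab.
  have [nb _ _] := bc; have [nb' nc _] := bc'.
  have [[bb' _]|[bc'' _]//] := bond_irreducible xirr bc bc'.
  by case: (away_excl b b').
split; [by split | split=> //= | by move=> b; rewrite /= eqxx => -[]].
- move=> f b c; have [->|->] := eq_or_neg f e; rewrite ?negbK eqxx neqF.
    exact: opp'.
  move=> hb hc.
  exact/straddlesC/opp'.
- move=> b c bc; have [ab|ac] := away_or _ _ bc.
    by exists e; rewrite eqxx neqF; split=> //; exists b.
  exists (~~ e); rewrite negbK eqxx neqF; split=> //.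
  by exists c => //; apply: straddlesC.
- move=> f b; have [->|->] := eq_or_neg f e; rewrite ?negbK eqxx neqF.
    by move=> ab; have [[c bc] _ _] := ab; exists c, b.
  by move=> [b' ab' _]; exists b'.
Qed.

Hypothesis Kcovers : minimal_covers.

Lemma minimal_side s e x : well_sided s -> s.2 e x ->
  exists y, [/\ y <= x, minimal_in (s.2 e) y & irreducible y].
Proof.
move=> ws sx; have [irr opp _ ne] := ws; have [w sw] := ne _ _ sx.
have [px pw pxw] := opp _ _ _ sx sw.
have [y yx ymin] := Kcovers pxw; have py : ~ s.1 <= y.
  by move=> /le_trans/(_ yx).
exists y; split=> //; last exact: minimal_cover_irreducible irr py ymin.
case: ymin => /= pyw ymin; split; first by apply: straddles_side ws _ sw.
by move=> z zy /opp/(_ sw)[_ _]; apply: ymin.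
Qed.

End Sides.

(** * Zigzag orders *)

Section Zigzag.
Context {T : choiceType}.

(** A vertex of a tree whose edges are tagged as going up or down, given by the
    sequence of the tagged edges to the root, the last edge first. Each edge is
    labelled with its far end. *)
Definition zigzag : Type := seq (bool * T).
HB.instance Definition _ := Choice.on zigzag.
Implicit Types (r s t u a b c : seq (bool * T)).

Definition run (e : bool) a : bool := all (fun x => x.1 == e) a.

(** The path from s to t goes from s towards the root, up to their common part
    r, and then returns to t; it is increasing when the edges leading from r to
    s are tagged [false] and those leading from r to t are tagged [true]. *)
Definition zigzag_le (s t : zigzag) : bool :=
  `[< exists r a b, [/\ s = a ++ r, t = b ++ r, run false a & run true b] >].

Lemma cat_eq_cat a b r s : a ++ r = b ++ s ->
  (exists c, s = c ++ r /\ a = b ++ c) \/ (exists c, r = c ++ s /\ b = a ++ c).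
Proof.
elim: a b => [|x a IH] [|y b] /=; first by move=> ->; left; exists [::].
- by move=> ->; right; exists (y :: b).
- by move=> <-; left; exists (x :: a).
case=> -> /IH[[c [-> ->]]|[c [-> ->]]]; last by right; exists c.
by left; exists c.
Qed.

Lemma cat_cancelr a b r : a ++ r = b ++ r -> a = b.
Proof.
move=> /(congr1 rev)/eqP; rewrite !rev_cat eqseq_cat // eqxx.
by move=> /eqP/(can_inj revK).
Qed.

Lemma run_nil e a : run e a -> run (~~ e) a -> a = [::].
Proof. by case: a => // -[f x] a /= /andP[/eqP-> _] /andP[]; case: e. Qed.

Fact zigzag_le_refl : reflexive zigzag_le.
Proof. by move=> s; apply/asboolP; exists s, [::], [::]. Qed.

Fact zigzag_le_anti : antisymmetric zigzag_le.
Proof.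
move=> s t /andP[/asboolP[r [a [b [-> -> fa tb]]]]].
move=> /asboolP[r' [a' [b' [eb ea fa' tb']]]].
have [[c [er ec]]|[c [er ec]]] := cat_eq_cat eb; subst.
  move: ea; rewrite catA => /cat_cancelr ec; subst.
  move: fa tb; rewrite /run !all_cat => /andP[fb' fc] /andP[ta' tc].
  by rewrite (run_nil fb' tb') (run_nil fc tc) (run_nil fa' ta').
move: ea; rewrite catA => /cat_cancelr ec; subst.
move: fa' tb'; rewrite /run !all_cat => /andP[fb fc] /andP[ta tc].
by rewrite (run_nil fa ta) (run_nil fc tc) (run_nil fb tb).
Qed.

Fact zigzag_le_trans : transitive zigzag_le.
Proof.
move=> t s u /asboolP[r [a [b [-> et fa tb]]]].
move=> /asboolP[r' [a' [b' [et' -> fa' tb']]]]; apply/asboolP; subst.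
have [[c [er ec]]|[c [er ec]]] := cat_eq_cat et'; subst.
  move: tb; rewrite /run all_cat => /andP[_ tc].
  exists r, a, (b' ++ c); rewrite catA; split=> //.
  by rewrite /run all_cat; apply/andP.
move: fa'; rewrite /run all_cat => /andP[_ fc].
exists r', (a ++ c), b'; rewrite catA; split=> //.
by rewrite /run all_cat; apply/andP.
Qed.

HB.instance Definition _ := Order.Le_isPOrder.Build set_display zigzag
  zigzag_le_refl zigzag_le_anti zigzag_le_trans.

Definition climb (e : bool) s : nat := count (fun x => x.1 == e) s.

Lemma climb_cat e a b : climb e (a ++ b) = (climb e a + climb e b)%N.
Proof. exact: count_cat. Qed.

Lemma climb_run e a : run e a -> climb e a = size a /\ climb (~~ e) a = 0%N.
Proof.
elim: a => // x a IH /= /andP[/eqP-> /IH[-> ->]].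
by rewrite eqxx; case: (e).
Qed.

Lemma zigzag_leP (s t : zigzag) : s <= t <->
  exists r a b, [/\ s = a ++ r, t = b ++ r, run false a & run true b].
Proof. by split=> /asboolP. Qed.

Lemma climb_le r a b : run false a -> run true b ->
  (climb true (b ++ r) + climb false (a ++ r) =
   climb true (a ++ r) + climb false (b ++ r) + (size a + size b))%N.
Proof.
move=> /climb_run[/= fa ta] /climb_run[/= tb fb].
by rewrite !climb_cat fa ta tb fb; lia.
Qed.

Lemma zigzag_climb_lt (s t : zigzag) : s < t ->
  (climb true s + climb false t < climb true t + climb false s)%N.
Proof.
rewrite lt_neqAle => /andP[st /zigzag_leP[r [a [b [es et fa tb]]]]]; subst.
have := climb_le r fa tb; case: a b st {fa tb} => [|x a] [|y b] st /=; try lia.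
by rewrite eqxx in st.
Qed.

End Zigzag.
Arguments zigzag : clear implicits.

(** The number of upward edges minus the number of downward ones grows at each
    strict inequality; the statement avoids subtraction. *)
Lemma chain_climb (T : choiceType) d (P : porderType d) (f : P -> zigzag T)
    (C : {fset P}) n :
  {in C &, forall x y, x >=< y} -> (forall x y, x < y -> f x < f y) ->
  (n < #|` C|)%N ->
  exists x y, x <= y /\
    (climb true (f x) + climb false (f y) + n <=
     climb true (f y) + climb false (f x))%N.
Proof.
move=> Cchain fmono nC.
have : sorted <%O (sort <=%O (enum_fset C)).
  rewrite lt_sorted_uniq_le sort_uniq fset_uniq /=.
  by apply: (@sort_sorted_in _ (mem C)) => //; apply/allP.
have := size_sort <=%O (enum_fset C); case: (sort _ _) => [|x s] /= sC xs.
  by rewrite -sC in nC.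
have {nC sC} ns : (n <= size s)%N by rewrite -ltnS sC.
suff [xy H] : x <= last x s /\
    (climb true (f x) + climb false (f (last x s)) + size s <=
     climb true (f (last x s)) + climb false (f x))%N.
  by exists x, (last x s); split=> //; lia.
elim: s x xs {ns} => [|y s IH] x /=; first by rewrite addn0.
move=> /andP[xy /IH[ys H]]; split; first exact: le_trans (ltW xy) ys.
have arith (a b c a' b' c' m : nat) :
  (a + b' < b + a' -> b + c' + m <= c + b' -> a + c' + m.+1 <= c + a')%N by lia.
exact: arith (zigzag_climb_lt (fmono _ _ xy)) H.
Qed.

(** * The poset of itineraries *)

Section Itineraries.
Context {d : Order.disp_t} {K : latticeType d}.
Implicit Types (p x y z w m : K) (e f : bool).

HB.instance Definition _ := Choice.on (@state d K).

Notation leg := (bool * @state d K)%type.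
Notation path_of := (seq leg).
Implicit Types (r s t u a b : path_of).

(** The first vertex also carries a tag. As it is always [true], the tree is a
    forest: two itineraries with different starting points would be comparable
    only through the empty sequence, and so one would consist of downward edges
    alone. *)
Fixpoint itinerary (s : path_of) : Prop :=
  match s with
  | [::] => False
  | (e, t) :: s' =>
      match s' with
      | [::] => e = true /\ well_sided t
      | (_, t') :: _ => step e t' t /\ itinerary s'
      end
  end.

Record node : Type :=
  Node { steps : zigzag (@state d K); _ : `[< itinerary steps >] }.

HB.instance Definition _ := [isSub for steps].
HB.instance Definition _ := [Choice of node by <:].
HB.instance Definition _ :=
  [SubChoice_isSubPOrder of node by <: with set_display].

Lemma nodeP (n : node) : itinerary (steps n).
Proof. by case: n => s /= /asboolP. Qed.

Lemma itinerary_well_sided (x : leg) s : itinerary (x :: s) -> well_sided x.2.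
Proof. by case: x s => [e t] [|[f t'] s] /= [] // []. Qed.

Lemma itinerary_suffix a (x : leg) s :
  itinerary (a ++ x :: s) -> itinerary (x :: s).
Proof.
elim: a => // -[e t] a IH /=.
by case: a IH => [|[f t'] a] IH; [case: x IH => f t' _ [] | case=> _ /IH].
Qed.

Lemma itinerary_step (x y : leg) s :
  itinerary (x :: y :: s) -> step x.1 y.2 x.2.
Proof. by case: x y => [e t] [f t'] []. Qed.

Lemma itinerary_root e s : itinerary s -> run e s -> e = true.
Proof.
elim: s => // -[f t] [|[g t'] s] IH /=; first by move=> [-> _] /andP[/eqP].
by move=> [_ /IH H] /andP[_ /H].
Qed.

Lemma run_cons e (x : leg) a : run e (x :: a) = (x.1 == e) && run e a.
Proof. by []. Qed.

Lemma run_side_incl e (x : leg) a (y : leg) r v :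
  itinerary (x :: a ++ y :: r) ->
  run e (x :: a) -> x.2.2 e v -> y.2.2 e v.
Proof.
elim: a x => [|z a IH] x iti; rewrite run_cons => /andP[/eqP xe ra] xv.
  have := itinerary_step iti; rewrite xe => /step_side; apply=> //.
  exact: itinerary_well_sided (itinerary_suffix (a := [:: x]) iti).
have itz := itinerary_suffix (a := [:: x]) iti.
apply: (IH _ itz ra); have := itinerary_step iti; rewrite xe => /step_side.
by apply=> //; apply: itinerary_well_sided itz.
Qed.

Lemma run_side e (x : leg) a (y : leg) r : itinerary (x :: a ++ y :: r) ->
  run e (x :: a) -> y.2.2 e x.2.1.
Proof.
case: a => [|z a] iti; rewrite run_cons => /andP[/eqP xe ra];
  have [[xmin _] _ _] := itinerary_step iti; rewrite xe in xmin => //.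
exact: run_side_incl (itinerary_suffix (a := [:: x]) iti) ra xmin.
Qed.

Definition ends_below m s : Prop :=
  if s is x :: _ then x.2.1 <= m else False.

(** The three nodes are on a monotone path that turns at [y]. If the middle one
    is at the turn, the two others are on opposite sides of it. Otherwise, it
    is a step from its predecessor t1, so its element z satisfies z <= t1 \/ v
    for each v further along, and induction puts t1 below m. *)
Lemma bent_path_convex e m (y : leg) r a b b' :
  itinerary (a ++ y :: r) -> itinerary (b' ++ b ++ y :: r) ->
  run (~~ e) a -> run e b -> run e b' ->
  ends_below m (a ++ y :: r) -> ends_below m (b' ++ b ++ y :: r) ->
  ends_below m (b ++ y :: r).
Proof.
move=> ia + ra; elim: b b' => [|z b IH] b' ib rb rb' ma mb.
  case: a ia ra ma => // x a ia ra /= xm; case: b' ib rb' mb => // x' b' ib rb'.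
  move=> /= xm' ; have [_ opp _ _] : well_sided y.2.
    exact: itinerary_well_sided (itinerary_suffix ia).
  have := opp (~~ e) _ _ (run_side ia ra); rewrite negbK.
  by move=> /(_ _ (run_side ib rb'))[_ _] /le_trans; apply; rewrite leUx xm.
case: b' ib rb' mb => // x' b' ib rb' mb /=.
move: rb; rewrite run_cons => /andP[/eqP ze rb].
have ibs : itinerary ((rcons (x' :: b') z) ++ b ++ y :: r) by rewrite cat_rcons.
have := IH _ ibs rb; rewrite /run all_rcons ze eqxx => /(_ rb' ma).
rewrite cat_rcons => /(_ mb).
have iz : itinerary (z :: (b ++ y :: r)) := itinerary_suffix (a := x' :: b') ib.
have zx' : z.2.2 e x'.2.1 by apply: run_side ib rb'.
case: (b ++ y :: r) iz => [|t1 s1] // /itinerary_step[_ _].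
rewrite ze => /(_ _ zx')[zle _] /= t1m.
by apply: le_trans zle _; rewrite leUx t1m.
Qed.

Definition nodes_below m : set node := [set n | ends_below m (steps n)].

Lemma nodes_below_convex m : `[< order_convex (nodes_below m) >].
Proof.
apply/asboolP => s u t st tu; rewrite /nodes_below /=.
move: st tu; rewrite -!Order.le_val /=.
have := nodeP s; have := nodeP u; have := nodeP t.
move: (steps s) (steps u) (steps t) => {}s {}u {}t it iu is_.
move=> /zigzag_leP[r [a [b [es et fa tb]]]].
move=> /zigzag_leP[r' [a' [b' [et' eu fa' tb']]]] sm um.
case: r es et => [|y r] es et.
  subst; rewrite !cats0 in it is_.
  by have := itinerary_root is_ fa.
case: r' et' eu => [|y' r'] et' eu.
  subst; rewrite !cats0 in iu et'.
  by have := itinerary_root it; rewrite et' => /(_ _ fa').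
subst.
have [[c [er ec]]|[c [er ec]]] := cat_eq_cat et'.
  move: tb; rewrite ec /run all_cat => /andP[ta' tc].
  rewrite (run_nil fa' ta') /= in ec *; subst.
  rewrite er in iu um *.
  exact: (@bent_path_convex true) is_ iu fa tc tb' sm um.
move: fa'; rewrite ec /run all_cat => /andP[fb fc].
rewrite (run_nil fb tb) /= in ec *; subst.
rewrite er in is_ sm; suff : ends_below m (c ++ y' :: r') by rewrite -er.
exact: (@bent_path_convex false) iu is_ tb' fc fa um sm.
Qed.

Definition nodes_below_Co m : Co node := MkCo (nodes_below_convex m).

Lemma nodes_belowE m (n : node) :
  nodes_below_Co m \has n <-> ends_below m (steps n).
Proof. by []. Qed.

Lemma ends_belowI x y s :
  ends_below (x `&` y) s <-> ends_below x s /\ ends_below y s.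
Proof.
case: s => [|z s] /=; first by split=> // -[].
by rewrite lexI; split=> /andP.
Qed.

Lemma ends_below_mono x y s : x <= y -> ends_below x s -> ends_below y s.
Proof. by case: s => //= z s xy /le_trans; apply. Qed.

Hypothesis Kstirlitz : satisfies K (rule_identity stirlitz).
Hypothesis Kudav : satisfies K (rule_identity udav).
Hypothesis Kbond : satisfies K (rule_identity bond).
Hypothesis Kcovers : minimal_covers (K := K).

(** The new node is adjacent to n in the tree, hence comparable to it; the step
    goes to a minimal irreducible element below x. *)
Lemma node_extend (n : node) e x (y : leg) s :
  steps n = y :: s -> y.2.2 e x -> reaches e n (nodes_below_Co x).
Proof.
move=> ns yx; have := nodeP n; rewrite ns => iti.
have ws := itinerary_well_sided iti.
have [x' [x'x x'min x'irr]] := minimal_side Kstirlitz Kcovers ws yx.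
have [sd st] := step_exists Kstirlitz Kudav Kbond ws x'min x'irr.
have iti' : itinerary ((e, (x', sd)) :: y :: s).
  by case: y ns yx iti ws x'min st => f t ns yx iti ws x'min st.
exists (Node (asboolT iti')); first by apply/nodes_belowE.
have neq : (n == Node (asboolT iti')) = false.
  apply/eqP => /(congr1 steps) /=; rewrite ns.
  by move=> /(congr1 size) /= []; lia.
rewrite /beyond; case: e {yx x'min st} iti' neq => iti' neq.
  rewrite lt_neqAle neq /= -Order.le_val /=; apply/zigzag_leP.
  by exists (y :: s), [::], [:: (true, (x', sd))].
rewrite lt_neqAle eq_sym neq /= -Order.le_val /=; apply/zigzag_leP.
by exists (y :: s), [:: (false, (x', sd))], [::].
Qed.

Lemma nodes_belowI x y :
  nodes_below_Co (x `&` y) = nodes_below_Co x `&` nodes_below_Co y.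
Proof.
by apply/le_anti/andP; split; apply/Co_leP => n;
  rewrite Co_meetE !nodes_belowE ends_belowI.
Qed.

(** If the last element of a node is below x \/ y but not below x or y, its
    sides contain x and y, in opposite directions, and the node has neighbours
    there. *)
Lemma nodes_belowU x y :
  nodes_below_Co (x `|` y) = nodes_below_Co x `|` nodes_below_Co y.
Proof.
apply/le_anti/andP; split; last first.
  rewrite leUx; apply/andP; split; apply/Co_leP => n /nodes_belowE H;
    apply/nodes_belowE; apply: ends_below_mono H; [exact: leUl | exact: leUr].
apply/Co_leP => n /nodes_belowE nxy; apply/Co_joinE.
case ns : (steps n) nxy => [|z s] //= zxy.
have [zx|zx] := pselect (z.2.1 <= x).
  by apply: Or31; apply/nodes_belowE; rewrite ns.
have [zy|zy] := pselect (z.2.1 <= y).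
  by apply: Or32; apply/nodes_belowE; rewrite ns.
have := nodeP n; rewrite ns => /itinerary_well_sided[_ _ cov _].
have [e [ex ey]] := cov _ _ (And3 zx zy zxy).
apply: Or33; exists e.
by split; [apply: node_extend ns ex | apply: node_extend ns ey].
Qed.

Lemma nodes_below_neq x y p : irreducible p -> p <= x -> ~ p <= y ->
  nodes_below_Co x <> nodes_below_Co y.
Proof.
move=> irr px py eq_xy; have [sd ws] := well_sided_exists Kudav Kbond irr.
have iti : itinerary [:: (true, (p, sd))] by [].
apply: py; suff /nodes_belowE : nodes_below_Co y \has Node (asboolT iti) by [].
by rewrite -eq_xy; apply/nodes_belowE.
Qed.

(** * The length of the poset of itineraries *)

(** The conditions on the values of the variables under which an arm is free of
    deviations: here p, z, z', ... are consecutive elements on a monotone path,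
    and w' is opposite to z' with respect to z. *)
Fixpoint straight (p c z : K) (l : seq (K * K)) : Prop :=
  if l is (z', w') :: l' then
    [/\ minimal_in [set x | p <= x `|` c] z, straddles z z' w',
        ~ (z <= p `|` w' /\ p <= w' `|` c) & straight z w' z' l']
  else True.

Definition values (v : nat -> K) (l : seq (lattice_term * lattice_term)) :=
  [seq (leval v zw.1, leval v zw.2) | zw <- l].

Lemma straight_arm v p q (z : lattice_term) l :
  straight p q (leval v z) (values v l) ->
  leval v (arm z l) = leval v z.
Proof.
elim: l p q z => [|[z' w'] l IH] p q z //= [_ [_ _ zz] _ /IH ->].
exact/meet_idPl.
Qed.

Lemma deviations_le (v : nat -> K) (a c z t : lattice_term) l :
  List.In t (deviations a c z l) -> leval v t <= leval v a.
Proof.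
case: l => [|[z' w'] l] //= [<-|[<-|[<-|]]] /=; rewrite ?leIl //.
by move=> /List.in_map_iff[t' [<- _]] /=; apply: leIl.
Qed.

(** As z is minimal, a deviation above [a] forces z <= z', or z <= w', or both
    z <= a \/ w' and a <= w' \/ c, or a deviation above z further along the
    arm. *)
Lemma straight_no_deviation v (a c z t : lattice_term) l :
  straight (leval v a) (leval v c) (leval v z) (values v l) ->
  List.In t (deviations a c z l) -> ~ leval v a <= leval v t.
Proof.
elim: l a c z t => [|[z' w'] l IH] a c z t //=.
move=> [[_ zmin] [nz nw zz] nback str].
have armE := straight_arm str.
have cut x : leval v a <= leval v a `&` ((leval v z `&` x) `|` leval v c) ->
    leval v z <= x.
  rewrite lexI => /andP[_ /(zmin _ (leIl _ _))].
  by rewrite lexI => /andP[].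
case=> [<-|[<-|[<-|]]] /=; [by move=> /cut; rewrite armE | by move=> /cut | |].
  rewrite !lexI => /and3P[_ azc awc]; apply: nback; split=> //.
  by apply: cut; rewrite lexI lexx.
move=> /List.in_map_iff[t' [<- t'dev]] /=.
rewrite lexI => /andP[_ at']; apply: (IH _ _ _ _ str t'dev).
exact: zmin (deviations_le v t'dev) at'.
Qed.

Lemma minimal_side_cover (s : state) e x w : well_sided s ->
  minimal_in (s.2 e) x -> s.2 (~~ e) w ->
  minimal_in [set z | s.1 <= z `|` w] x.
Proof.
move=> ws [sx xmin] sw; have [_ opp _ _] := ws.
have [nx nw xw] := opp _ _ _ sx sw; split=> // z zx /= zw.
apply: xmin => //; apply: straddles_side ws _ sw; split=> //.
by move=> /le_trans/(_ zx).
Qed.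

(** The first k vertices on the path from [y] give the arm, and any element of
    the side of the last of them ends it; the path needs a further step only to
    show that this side is inhabited. *)
Lemma straight_exists e k a (y : leg) r : itinerary (a ++ y :: r) -> run e a ->
  (exists z, y.2.2 e z) -> (k <= (size a).-1)%N ->
  exists z l, [/\ size l = k, y.2.2 e z &
    forall c, y.2.2 (~~ e) c -> straight y.2.1 c z l].
Proof.
elim: k a y r => [|k IH] a y r iti ra [z0 yz0] ka; first by exists z0, [::].
case/lastP: a iti ra ka => // a x; rewrite cat_rcons size_rcons => iti.
rewrite /run all_rcons => /andP[/eqP xe ra] ka.
have itx := itinerary_suffix iti; have wx := itinerary_well_sided itx.
have wy := itinerary_well_sided (itinerary_suffix (a := [:: x]) itx).
have [xmin _ away] := itinerary_step itx; rewrite xe in xmin away.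
have xne : exists z, x.2.2 e z.
  case: a iti ra ka => // g a iti ra _.
  by exists g.2.1; apply: run_side iti ra.
have [|z [l [lk xz str]]] := IH a x (y :: r) iti ra xne.
  by rewrite /= in ka *; lia.
have [_ oppx _ nex] := wx; have [w xw] := nex _ _ xz.
exists x.2.1, ((z, w) :: l); split; [by rewrite /= lk | by case: xmin |].
move=> c yc; split; last exact: str.
- exact: minimal_side_cover wy xmin yc.
- exact: oppx xz xw.
case=> xyw ywc; have [xyz yzc] := away _ xz.
have [_ oppy _ _] := wy; have [xy _] := xmin.
have [_ nyc yxc] := oppy _ _ _ xy yc; have [xirr _ _ _] := wx.
have sxzw := oppx _ _ _ xz xw.
exact: (away_unique Kudav xirr nyc yxc sxzw xyz (yzc _ yc) xyw ywc).
Qed.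

(** The valuation that sends the variables of [zvar] and [wvar] to given
    values, by decoding their numbers. *)
Definition arm_values (p : K) (z : bool -> K) (l : bool -> seq (K * K))
    (i : nat) : K :=
  if i isn't j.+1 then p else
  if choice.unpickle j is Some (e, is_w, k) then
    if k isn't h.+1 then z e else
    let zw := nth (p, p) (l e) h in if is_w then zw.2 else zw.1
  else p.

Lemma arm_values_zvar p (z : bool -> K) l e :
  leval (arm_values p z l) (zvar e 0) = z e.
Proof. by rewrite /= choice.pickleK. Qed.

Lemma values_arm_vars p (z : bool -> K) l e :
  values (arm_values p z l) (arm_vars e (size (l e))) = l e.
Proof.
rewrite /values /arm_vars -map_comp -[RHS](mkseq_nth (p, p)).
by apply: eq_map => i /=; rewrite !choice.pickleK; case: (nth _ _ _).
Qed.

Lemma length_rule_straight k l p (z : bool -> K) (m : bool -> seq (K * K)) :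
  satisfies K (rule_identity (length_rule k l)) ->
  size (m false) = k -> size (m true) = l -> irreducible p ->
  straddles p (z false) (z true) ->
  straight p (z true) (z false) (m false) ->
  ~ straight p (z false) (z true) (m true).
Proof.
move=> Klen mk ml irr [nz ny zy] strz stry.
pose v := arm_values p z m.
have armz : leval v (arm (zvar false 0) (arm_vars false k)) = z false.
  rewrite -(arm_values_zvar p z m).
  apply: (straight_arm (p := p) (q := z true)).
  by rewrite arm_values_zvar -mk values_arm_vars.
have army : leval v (arm (zvar true 0) (arm_vars true l)) = z true.
  rewrite -(arm_values_zvar p z m).
  apply: (straight_arm (p := p) (q := z false)).
  by rewrite arm_values_zvar -ml values_arm_vars.
have [|t [t_in pt]] := irreducible_rule (v := v) Klen irr.
  by rewrite [premise _]/= [leval _ _]/= armz army.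
case: t_in pt => [<-|[<-|]]; [by rewrite armz | by rewrite army |].
move=> /List.in_app_iff[] /(straight_no_deviation (v := v)); apply.
  by rewrite army arm_values_zvar -mk values_arm_vars.
by rewrite armz arm_values_zvar -ml values_arm_vars.
Qed.

(** A chain of n + 2 nodes contains two that are joined by a monotone path of
    at least n + 1 steps. At its turning point both sides are inhabited, so
    that an arm exists even on a side where the path has no step. *)
Lemma node_length n :
  (0 < n)%N ->
  (forall k, (k < n)%N ->
    satisfies K (rule_identity (length_rule k (n.-1 - k)))) ->
  length_at_most node n.
Proof.
move=> n0 Klen C Cchain; rewrite leqNgt subn1 ltn_predRL; apply/negP => nC.
have smono (x y : node) : x < y -> (steps x : zigzag _) < steps y.
  by rewrite !lt_neqAle -Order.le_val.
have [x [y [xy]]] := chain_climb Cchain smono nC.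
move: xy (nodeP x) (nodeP y); rewrite -Order.le_val /=.
move: (steps x) (steps y) => {x y}s t /zigzag_leP[r [a [b [-> -> fa tb]]]].
rewrite (climb_le r fa tb) leq_add2l => is_ it ab.
case: r is_ it => [|y r] is_ it.
  rewrite !cats0 in is_ it.
  by have := itinerary_root is_ fa.
have wy := itinerary_well_sided (itinerary_suffix is_).
have [irr opp _ ne] := wy.
have side0 (e : bool) c (g : leg) : itinerary ((g :: c) ++ y :: r) ->
    run e (g :: c) -> forall f, exists z, y.2.2 f z.
  move=> iti rc f; have yg := run_side iti rc.
  by have [->|->] := eq_or_neg f e; [exists g.2.1 | apply: ne yg].
have sides e : exists z, y.2.2 e z.
  case: a is_ fa ab => [|g a] is_ fa ab; last exact: side0 is_ fa e.
  case: b it tb ab => [|g b] it tb ab; last exact: side0 it tb e.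
  by [].
(* An arm given by a list of length k has k + 1 steps; the two arms are cut so
   as to have n + 1 steps in total. *)
pose k := minn (size a).-1 n.-1.
have kn : (k < n)%N by rewrite /k; lia.
have [|z0 [l0 [l0k yz0 str0]]] :=
    @straight_exists false k a y r is_ fa (sides _).
  exact: geq_minl.
have [|z1 [l1 [l1k yz1 str1]]] :=
    @straight_exists true (n.-1 - k) b y r it tb (sides _).
  have arith (i j m : nat) :
    (m < i + j -> m.-1 - minn i.-1 m.-1 <= j.-1)%N by lia.
  exact: arith ab.
apply: (length_rule_straight (Klen k kn) (z := fun e => if e then z1 else z0)
  (m := fun e => if e then l1 else l0) l0k l1k irr (opp _ _ _ yz0 yz1)) => /=.
  exact: str0.
exact: str1.
Qed.

End Itineraries.

(** * A finite basis *)

Definition length_basis (n : nat) : seq lattice_identity :=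
  map rule_identity
    [:: stirlitz, udav, bond & [seq length_rule k (n.-1 - k) | k <- iota 0 n]].

Lemma In_map (A B : Type) (f : A -> B) s y :
  List.In y (map f s) <-> exists x, f x = y /\ List.In x s.
Proof. exact: List.in_map_iff. Qed.

Lemma length_basisP n e : List.In e (length_basis n) <->
  exists r, e = rule_identity r /\
    [\/ r = stirlitz, r = udav, r = bond |
        exists2 k, (k < n)%N & r = length_rule k (n.-1 - k)].
Proof.
have iotaP m h k : List.In k (iota m h) <-> (m <= k < m + h)%N.
  elim: h m => [|h IH] m /=; first by split=> //; lia.
  rewrite IH; split; first by case=> [->|]; lia.
  by case: (eqVneq m k) => [|mk] H; [left | right; lia].
rewrite /length_basis; split.
  move=> H; have [r [<- /= r_in]] := (In_map _ _ _).1 H.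
  case: r_in {H} => [<-|[<-|[<-|]]].
  - by exists stirlitz; split=> //; apply: Or41.
  - by exists udav; split=> //; apply: Or42.
  - by exists bond; split=> //; apply: Or43.
  move=> /In_map[k [<- /iotaP kn]].
  by eexists; split; first reflexivity; apply: Or44; exists k.
case=> r [-> H]; apply/In_map; exists r; split=> //=.
case: H => [->|->|->|[k kn ->]]; [by left | by right; left |
  by right; right; left |].
by do 3 right; apply/In_map; exists k; split=> //; apply/iotaP.
Qed.

(** If F is the intersection of two filters, one of them omits c as well. *)
Lemma filter_maximal_irreducible d (L : latticeType d) (F : lfilter L)
    (c : L) :
  (forall H, H <= F -> ~ filter_set H c -> F <= H) -> ~ filter_set F c ->
  irreducible F.
Proof.
move=> Fmax Fc G H FGH.
have [Gc|Gc] := pselect (filter_set G c); last first.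
  by left; apply/le_anti; rewrite Fmax // FGH leUl.
have [Hc|Hc] := pselect (filter_set H c); last first.
  by right; apply/le_anti; rewrite Fmax // FGH leUr.
by case: Fc; rewrite FGH filter_joinE.
Qed.

(** For filters, p <= z \/ y means that no element of y outside p is in z. *)
Lemma filter_minimal_covers d (L : latticeType d) :
  minimal_covers (K := lfilter L).
Proof.
move=> p x y /filter_leP pxy.
pose N : set L := [set c | filter_set y c /\ ~ filter_set p c].
have coverP z : p <= z `|` y <-> forall c, filter_set z c -> ~ N c.
  split=> [/filter_leP pzy c zc [yc]|zN]; first by apply; apply: pzy.
  by apply/filter_leP => c [zc yc]; apply: contrapT => npc; apply: (zN c).
have [|z [zx /coverP zN zmax]] := @filter_maximal _ _ x N.
  by apply/coverP/filter_leP.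
exists z => //; split=> // w wz /coverP wN; exact: zmax.
Qed.

Lemma SUB_satisfies n d (L : latticeType d) e : (0 < n)%N ->
  SUB n L -> List.In e (length_basis n) -> satisfies L e.
Proof.
move=> n0 [d' [P [len emb]]] /length_basisP[r [-> r_in]].
apply: satisfies_embeds emb _.
case: r_in => [->|->|->|[k kn ->]];
  [exact: Co_stirlitz | exact: Co_udav | exact: Co_bond |].
apply: Co_length_rule; congr length_at_most : len; lia.
Qed.

(** The embedding is a |-> the set of the nodes ending below the principal
    filter of a. It is injective because, if a is not below b, a filter that is
    maximal among those containing a and omitting b is join-irreducible. *)
Lemma satisfies_SUB n d (L : latticeType d) : (0 < n)%N ->
  (forall e, List.In e (length_basis n) -> satisfies L e) -> SUB n L.
Proof.
move=> n0 sat.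
have Ksat r : List.In (rule_identity r) (length_basis n) ->
    satisfies (lfilter L) (rule_identity r).
  by move=> /sat; apply: satisfies_filter.
have Kst : satisfies (lfilter L) (rule_identity stirlitz).
  by apply: Ksat; left.
have Kud : satisfies (lfilter L) (rule_identity udav).
  by apply: Ksat; right; left.
have Kbo : satisfies (lfilter L) (rule_identity bond).
  by apply: Ksat; right; right; left.
have Kco := @filter_minimal_covers d L.
exists set_display, (@node _ (lfilter L)); split.
  apply: node_length => // k kn; apply: Ksat; apply/length_basisP.
  by eexists; split; first reflexivity; apply: Or44; exists k.
pose f (a : L) : Co (@node _ (lfilter L)) := nodes_below_Co (principal a).
have fI : {morph f : a b / a `&` b >-> a `&` b}.
  by move=> a b; rewrite /f principalI nodes_belowI.
have fU : {morph f : a b / a `|` b >-> a `|` b}.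
  by move=> a b; rewrite /f principalU nodes_belowU.
have fle : {homo f : a b / a <= b >-> a <= b}.
  by move=> a b /meet_idPl ab; rewrite -ab fI leIr.
pose F : {lmorphism L -> Co (@node _ (lfilter L))} :=
  HB.pack f (Order.isOrderMorphism.Build _ _ _ _ f fle)
            (Order.isMeetLatticeMorphism.Build _ _ _ _ f fI)
            (Order.isJoinLatticeMorphism.Build _ _ _ _ f fU).
exists F; have inj_le a b : f a = f b -> a <= b.
  move=> fab; apply: contrapT => nab.
  have [|p [pa pb pmax]] := @filter_maximal _ _ (principal a) [set b].
    by move=> c /= ac cb; rewrite cb in ac.
  have pb' : ~ filter_set p b by move=> /pb; apply.
  have irr : irreducible p.
    apply: (filter_maximal_irreducible (c := b)) => // H Hp Hb.
    by apply: pmax => // c Hc cb; apply: Hb; rewrite -cb.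
  by case: (nodes_below_neq Kud Kbo irr pa _ fab) => /le_principal.
by move=> a b /= fab; apply/le_anti; rewrite !inj_le.
Qed.

Close Scope order_scope.
Close Scope classical_set_scope.

Theorem theorem6p4 (n : nat) (hn : 0 < n) : finitely_based_variety (SUB n).
Proof.
exists (length_basis n) => d L; split=> [subL e|].
  exact: SUB_satisfies.
exact: satisfies_SUB.
Qed.
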